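(* Let $C$ be a finite set of constants and let $A$ and $B$ be two sets of atoms over $C$ that atomize models $[A]$ and $[B]$ over $C$. (i) If $[A]$ is freer or as free as $[B]$, then the model $A+B=[A\cup B]$ spawned by the atoms of $A$ and the atoms of $B$ is the same as the model $[A]$ spawned by $A$ alone. (ii) If $[A]$ is freer or as free as $[B]$, then every atom of $B$ is an atom of $A$ or is redundant with $[A]$. (iii) $[A]$ is freer or as free as $[B]$ if and only if every atom of $B$ is an atom of $A$ or a union of atoms of $A$.
   Context: A semilattice is a nonempty set with a commutative, associative, idempotent binary operation $\odot$, ordered by $a\le b$ iff $a\odot b=b$. For a finite set $C$ of constants, $F_C(\emptyset)$ is the free semilattice on $C$; its elements (terms) $t$ are identified with their nonempty sets $\mathbf{C}(t)\subseteq C$ of component constants, with $\odot$ acting as union. A semilattice model over $C$ is a semilattice $M$ with a map $C\to M$ whose image generates $M$; it induces the natural homomorphism $\nu_M:F_C(\emptyset)\to M$. A duple over $C$ is an ordered pair $r=(r_L,r_R)$ of terms; $M\models r^+$ means $\nu_M(r_L)\le\nu_M(r_R)$, and $M\models r^-$ means $\nu_M(r_L)\not\le\nu_M(r_R)$. Two models over $C$ are regarded as equal if they satisfy the same positive duples. For models $M,N$ over $C$, $M$ is freer or as free as $N$ if for every duple $r$ over $C$, $N\models r^-$ implies $M\models r^-$. An atom $\phi$ over $C$ is determined by a nonempty subset $\mathbf{U}^c(\phi)\subseteq C$; for a term $t$, $\phi<t$ means $\mathbf{C}(t)\cap\mathbf{U}^c(\phi)\ne\emptyset$. A set $A$ of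 atoms over $C$ atomizes (spawns) $M$, written $M=[A]$, if every $c\in C$ satisfies $\phi<c$ for some $\phi\in A$, and for all terms $t,s$: $\nu_M(t)\le\nu_M(s)$ iff there is no $\phi\in A$ with $\phi<t$ and $\phi\not<s$. An atom is in $M$ if it belongs to some set of atoms that atomizes $M$. An atom $\phi$ is redundant with $M$ if for each constant $c$ with $\phi<c$ there is an atom $\eta$ in $M$ with $\eta<c$ and $\mathbf{U}^c(\eta)\subsetneq\mathbf{U}^c(\phi)$. A union of (finitely many, at least one) atoms $\eta_i$ is the atom $\bigtriangledown_i\eta_i$ with $\mathbf{U}^c(\bigtriangledown_i\eta_i)=\bigcup_i\mathbf{U}^c(\eta_i)$. *)

(* Defs.v *)
From HB Require Import structures.
From mathcomp Require Import all_boot all_order.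

Set Implicit Arguments.
Unset Strict Implicit.
Unset Printing Implicit Defensive.

Import Order.TTheory.

(* Elements of the free semilattice F_C(0), identified with their nonempty    *)
(* sets of component constants.                                               *)
Record term (C : finType) := Term {
  comps :> {set C};
  comps_neq0 : comps != set0 }.

Record atom (C : finType) := Atom {
  Uc :> {set C};
  Uc_neq0 : Uc != set0 }.

HB.instance Definition _ (C : finType) := [isSub for @Uc C].
HB.instance Definition _ (C : finType) := [Finite of atom C by <:].

Section Terms.
Variable C : finType.

Lemma cst_neq0 (c : C) : [set c] != set0.
Proof. by apply/set0Pn; exists c; rewrite set11. Qed.

Definition cst (c : C) : term C := Term (cst_neq0 c).

Lemma term_join_neq0 (t s : term C) : comps t :|: comps s != set0.
Proof. by rewrite setU_eq0 negb_and comps_neq0. Qed.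

Definition term_join (t s : term C) : term C := Term (term_join_neq0 t s).

Definition atom_lt (phi : atom C) (t : term C) : bool :=
  comps t :&: Uc phi != set0.

Lemma atom_lt_cst (phi : atom C) (c : C) : atom_lt phi (cst c) = (c \in Uc phi).
Proof.
apply/set0Pn/idP => [[x]|cU]; first by rewrite !inE => /andP[/eqP->].
by exists c; rewrite !inE eqxx.
Qed.

End Terms.

(* The order of a joinSemilatticeType satisfies a <= b iff a `|` b = b        *)
(* (leEjoin); the library does not require its carrier to be inhabited.       *)
Record model (C : finType) := Model {
  mdisp : Order.disp_t;
  carrier :> joinSemilatticeType mdisp;
  carrier_inhabited : inhabited carrier;
  interp : C -> carrier;
  interp_generates : forall P : carrier -> Prop,
    (forall c, P (interp c)) ->
    (forall x y, P x -> P y -> P (Order.join x y)) ->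
    forall x, P x }.

Section Models.
Variable C : finType.

Lemma comps_witness (t : term C) : exists c, c \in comps t.
Proof. by apply/set0Pn/comps_neq0. Qed.

(* A join semilattice need not have a bottom, so the join over t starts from  *)
(* the value of some component of t; by idempotence this changes nothing.     *)
Definition nu (M : model C) (t : term C) : M :=
  \big[Order.join/interp M (xchoose (comps_witness t))]_(c in comps t)
    interp M c.

Lemma nu_le (M : model C) (t : term C) (x : M) :
  (nu M t <= x)%O <-> forall c, c \in comps t -> (interp M c <= x)%O.
Proof.
rewrite /nu; set c0 := xchoose _.
have c0t : c0 \in comps t := xchooseP (comps_witness t).
split=> [|H]; last first.
  elim/big_ind: _ => [|y z yx zx|c /H//]; first exact: H.
  by rewrite leUx yx.
move=> le c; rewrite -mem_enum => ct; move: le.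
rewrite -big_enum /=; elim: (enum _) ct => //= a s IH.
rewrite inE big_cons leUx => /orP[/eqP->|cs] /andP[] // _.
exact: IH.
Qed.

Lemma nu_cst (M : model C) (c : C) : nu M (cst c) = interp M c.
Proof.
apply/le_anti/andP; split.
  by apply/nu_le => d; rewrite inE => /eqP->.
have [H _] := nu_le (cst c) (nu M (cst c)).
by apply: H (lexx _) _ _; rewrite inE.
Qed.

Lemma nu_join (M : model C) (t s : term C) :
  nu M (term_join t s) = Order.join (nu M t) (nu M s).
Proof.
have H u c : c \in comps u -> (interp M c <= nu M u)%O.
  by have [+ _] := nu_le u (nu M u); apply.
apply/le_anti/andP; split.
  by apply/nu_le => d; rewrite inE => /orP[] /H dl; apply: lexU2; rewrite dl ?orbT.
rewrite leUx; apply/andP; split; apply/nu_le => d dt;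
  by apply: H; rewrite inE dt ?orbT.
Qed.

Definition duple : Type := (term C * term C)%type.

Definition sat_pos (M : model C) (r : duple) : Prop :=
  (nu M r.1 <= nu M r.2)%O.

Definition sat_neg (M : model C) (r : duple) : Prop :=
  ~ (nu M r.1 <= nu M r.2)%O.

Definition same_model (M N : model C) : Prop :=
  forall r : duple, sat_pos M r <-> sat_pos N r.

Definition freer (M N : model C) : Prop :=
  forall r : duple, sat_neg N r -> sat_neg M r.

(* M = [A]; since C is finite, every set of atoms over C is a {set atom C}.   *)
Definition atomizes (A : {set atom C}) (M : model C) : Prop :=
  (forall c : C, exists2 phi, phi \in A & atom_lt phi (cst c)) /\
  (forall t s : term C,
     (nu M t <= nu M s)%O <->
     ~ (exists2 phi, phi \in A & atom_lt phi t /\ ~ atom_lt phi s)).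

Definition atom_in (phi : atom C) (M : model C) : Prop :=
  exists2 A : {set atom C}, phi \in A & atomizes A M.

Definition redundant (phi : atom C) (M : model C) : Prop :=
  forall c : C, atom_lt phi (cst c) ->
    exists eta : atom C,
      [/\ atom_in eta M, atom_lt eta (cst c) & Uc eta \proper Uc phi].

Definition is_atom_union (phi : atom C) (S : {set atom C}) : Prop :=
  S != set0 /\ Uc phi = \bigcup_(eta in S) Uc eta.

End Models.

(* Main.v *)
(* Everything reduces to one characterisation: [A] is freer or as free as [B] *)
(* iff for each phi in B and c in U(phi) some eta in A satisfies              *)
(* c \in U(eta) \subset U(phi). For the direct implication, phi discriminates *)
(* the duple (c, ~: U(phi)), so [A] must have an atom that discriminates it   *)
(* too; when U(phi) is all of C, any atom of A below c will do.               *)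
Require Import Defs.
From mathcomp Require Import all_boot all_order.

(** For (i), when [A] is freer or as free as [B], every positive duple of [A] holds in [B], so atoms
    of [B] discriminate no duple that [A] satisfies. Parts (ii) and (iii) use the atoms [eta] of
    [freer_subatomP]: if [phi] is not in [A], they are strictly smaller than [phi], which gives
    redundancy; together they cover [phi], which makes it a union. *)

Section AtomizedModels.
Variable C : finType.
Implicit Types (A B : {set atom C}) (M N : model C) (phi eta : atom C).

Lemma atom_ltP phi (t : term C) :
  reflect (exists2 c, c \in comps t & c \in Uc phi) (atom_lt phi t).
Proof.
apply: (iffP (set0Pn _)) => [[c]|[c ct cphi]]; last by exists c; rewrite inE ct.
by rewrite inE => /andP[]; exists c.
Qed.

Lemma freerP M N :
  freer M N <->
  (forall t s : term C, (nu M t <= nu M s)%O -> (nu N t <= nu N s)%O).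
Proof.
split=> [MN t s Mts|MN r Nr Mr]; last exact/Nr/MN.
by apply/negP => /negP Nts; apply: (MN (t, s)); first exact/negP.
Qed.

Lemma atomizes_same_model A M N :
  atomizes A M -> atomizes A N -> same_model M N.
Proof. by move=> [_ AM] [_ AN] r; apply: iff_trans (AM _ _) (iff_sym (AN _ _)). Qed.

Lemma atomizes_setU A B M N :
  atomizes A M -> atomizes B N -> freer M N -> atomizes (A :|: B) M.
Proof.
move=> [covA AM] [_ BN] /freerP MN; split=> [c|t s].
  by have [phi phiA phic] := covA c; exists phi => //; rewrite inE phiA.
split=> [Mts [phi /setUP[phiA|phiB] ltphi]|noAB].
- by case/AM: Mts; exists phi.
- by case/MN/BN: Mts; exists phi.
- by apply/AM => -[phi phiA ltphi]; apply: noAB; exists phi; rewrite // inE phiA.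
Qed.

(** For the converse, if [phi] in [B] discriminates a duple (t, s) through a constant c of t, so
    does an [eta] in [A] with c in [Uc eta] and [Uc eta] inside [Uc phi]: being smaller, it also
    misses s. *)
Lemma freer_subatomP A B M N : atomizes A M -> atomizes B N ->
  freer M N <->
  (forall phi c, phi \in B -> c \in Uc phi ->
     exists2 eta, eta \in A & (c \in Uc eta) && (Uc eta \subset Uc phi)).
Proof.
move=> [covA AM] [_ BN]; apply: iff_trans (freerP M N) _.
split=> [MN phi c phiB cphi|subAB t s Mts].
  have [phiT|phiC0] := eqVneq (~: Uc phi) set0.
    have [eta etaA etac] := covA c; exists eta => //.
    by rewrite -atom_lt_cst etac -(setCK (Uc phi)) phiT setC0 subsetT.
  (* The largest term that [phi] is not below: an atom is not below it exactly when it is contained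
     in [phi]. *)
  pose s := Term phiC0.
  have Mcs : ~~ (nu M (cst c) <= nu M s)%O.
    apply/negP => /MN /BN; apply; exists phi => //.
    by rewrite atom_lt_cst /atom_lt /= setIC setICr eqxx.
  (* [AM] only refutes the absence of such an atom; a boolean quantifier over the finite type of
     atoms turns this into a witness. *)
  have /existsP[eta /and3P[etaA etac etas]] :
      [exists eta, [&& eta \in A, atom_lt eta (cst c) & ~~ atom_lt eta s]].
    apply: contraR Mcs => /existsPn noeta; apply/AM => -[eta etaA [etac /negP etas]].
    by have := noeta eta; rewrite etaA etac etas.
  exists eta => //; rewrite -atom_lt_cst etac /=.
  by move: etas; rewrite negbK setIC setI_eq0 disjoints_subset setCK.
apply/BN => -[phi phiB [/atom_ltP[c ct cphi] phis]].
have [eta etaA /andP[ceta /subsetP etaphi]] := subAB phi c phiB cphi.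
case/AM: Mts; exists eta => //; split; first by apply/atom_ltP; exists c.
by case/atom_ltP => d ds /etaphi dphi; apply: phis; apply/atom_ltP; exists d.
Qed.

Lemma atom_union_subatomP A phi :
  (phi \in A \/ exists S : {set atom C}, S \subset A /\ is_atom_union phi S) <->
  (forall c, c \in Uc phi ->
     exists2 eta, eta \in A & (c \in Uc eta) && (Uc eta \subset Uc phi)).
Proof.
split=> [[phiA c cphi|[S [/subsetP SA [_ phiS]]] c]|subA].
- by exists phi; rewrite // cphi subxx.
- rewrite phiS => /bigcupP[eta etaS ceta]; exists eta; first exact: SA.
  by rewrite ceta bigcup_sup.
(* The largest candidate: all atoms of [A] inside [phi]. *)
- right; exists [set eta in A | Uc eta \subset Uc phi]; split.
    by apply/subsetP => eta; rewrite inE => /andP[].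
  split.
    have /set0Pn[c /subA[eta etaA /andP[_ etaphi]]] := Uc_neq0 phi.
    by apply/set0Pn; exists eta; rewrite inE etaA.
  apply/eqP; rewrite eqEsubset; apply/andP; split.
    apply/subsetP => c /subA[eta etaA /andP[ceta etaphi]].
    by apply/bigcupP; exists eta; rewrite // inE etaA.
  by apply/bigcupsP => eta; rewrite inE => /andP[].
Qed.

End AtomizedModels.

Theorem theorem15 (C : finType) (A B : {set atom C}) (MA MB : model C)
    (hA : atomizes A MA) (hB : atomizes B MB) :
  (* (i) *)
  (freer MA MB ->
     (exists M : model C, atomizes (A :|: B) M) /\
     (forall M : model C, atomizes (A :|: B) M -> same_model M MA)) /\
  (* (ii) *)
  (freer MA MB ->
     forall phi : atom C, phi \in B -> phi \in A \/ redundant phi MA) /\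
  (* (iii) *)
  (freer MA MB <->
     forall phi : atom C, phi \in B ->
       phi \in A \/
       exists S : {set atom C}, S \subset A /\ is_atom_union phi S).
Proof.
have subP := freer_subatomP _ _ _ _ _ hA hB.
split=> [AB|]; last split=> [/subP subAB phi phiB|].
- have hAB := atomizes_setU _ _ _ _ _ hA hB AB.
  by split=> [|M hM]; [exists MA | apply: atomizes_same_model hM hAB].
- have [phiA|phiNA] := boolP (phi \in A); [by left | right=> c].
  rewrite atom_lt_cst => /(subAB _ _ phiB)[eta etaA /andP[ceta etaphi]].
  exists eta; split; [by exists A | by rewrite atom_lt_cst |].
  rewrite properEneq etaphi andbT.
  by apply: contraNneq phiNA => /val_inj <-.
- split=> [/subP subAB phi phiB|unionAB].
    by apply/(atom_union_subatomP _ A phi) => c; apply: subAB.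
  apply/subP => phi c phiB.
  by have /(atom_union_subatomP _ A phi) := unionAB _ phiB; apply.
Qed.
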